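(* For every Bayesian proposition $\lfloor\Gamma\rfloor$: $\vdash\lfloor\Gamma\rfloor$ if and only if $\vDash\lfloor\Gamma\rfloor$.
   Context: Language: $\mathcal{P}$ is a set of atomic propositions; the set $\mathcal{C}$ of conditional propositions is the smallest set containing $\bot$ and $\mathcal{P}$ and closed under $X\to Y$ and $[X]Y$. Abbreviations: $\neg X:=X\to\bot$, $X\vee Y:=\neg X\to Y$, $X\wedge Y:=\neg(\neg X\vee\neg Y)$, $\top:=\neg\bot$, $X\leftrightarrow Y:=(X\to Y)\wedge(Y\to X)$. A Bayesian proposition is $\lfloor X_1|\cdots|X_n\rfloor$ with $n\ge1$, $X_i\in\mathcal{C}$; $\Gamma,\Delta$ denote finite (possibly empty) sequences and $\lfloor\Gamma|X\rfloor$ denotes appending. Semantics: a Bayesian algebra is a Boolean algebra $(E,\cap,\cup,\sim,\bot,\top)$ with $[\;]:E\times E\to E$ such that for all $x,y$: $z\mapsto[x]z$ is a Boolean automorphism; $x\subset y$ implies $[x]y=\top$ or $x=\bot$; $x\cap[x]y=x\cap y$; $[x][x]y=[\sim x][x]y=[x]y$. A valuation in $E$ is $H:\mathcal{C}\to E$ with $H(\bot)=\bot$, $H(X\to Y)=\sim H(X)\cup H(Y)$, $H([X]Y)=[H(X)]H(Y)$. $H\vDash\lfloor X_1|\cdots|X_n\rfloor$ iff $H(X_i)=\top$ for some $i$; $\vDash\lfloor\Gamma\rfloor$ iff this holds for every valuation in every Bayesian algebra. Proof system: axioms are $\lfloor A\rfloor$ for every instance $A$ (over $\mathcal{C}$)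 of the axiom schemas of a standard Hilbert system for classical propositional logic in $\bot,\to$; $\lfloor[X](Y\to Z)\to([X]Y\to[X]Z)\rfloor$; $\lfloor[X]Y\to(X\to Y)\rfloor$; $\lfloor[X]\neg Y\leftrightarrow\neg[X]Y\rfloor$. Rules: from $\lfloor\Gamma|X\rfloor$ and $\lfloor\Delta|X\to Y\rfloor$ infer $\lfloor\Gamma|\Delta|Y\rfloor$; permute components; from $\lfloor\Gamma|X|X\rfloor$ infer $\lfloor\Gamma|X\rfloor$; from $\lfloor\Gamma\rfloor$ infer $\lfloor\Gamma|X\rfloor$; from $\lfloor\Gamma|X\to Y\rfloor$ infer $\lfloor\Gamma|\neg X|[X]Y\rfloor$; from $\lfloor\Gamma|Y\leftrightarrow\neg X\rfloor$ and $\lfloor\Gamma|[X]Z\leftrightarrow Z\rfloor$ infer $\lfloor\Gamma|[Y]Z\leftrightarrow Z\rfloor$. $\vdash\lfloor\Gamma\rfloor$ means derivable.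
   Formalization: The maps z ↦ [x]z are required only to be Boolean endomorphisms, not bijective: true automorphisms with [x][x]y=[x]y leave only algebras with at most two elements, making the underivable ⌊X|¬X⌋ valid. *)

(* Defs.v *)
From Stdlib Require Import Permutation.
From mathcomp Require Import all_boot all_order.

Set Implicit Arguments.
Unset Strict Implicit.
Unset Printing Implicit Defensive.

Import Order.Theory.
Local Open Scope order_scope.

(* [Cond X Y] is the conditional [X]Y. *)
Inductive cprop (P : Type) : Type :=
| Bot
| Atom of P
| Imp of cprop P & cprop P
| Cond of cprop P & cprop P.

Arguments Bot {P}.

Definition Neg (P : Type) (X : cprop P) : cprop P := Imp X Bot.
Definition Or (P : Type) (X Y : cprop P) : cprop P := Imp (Neg X) Y.
Definition And (P : Type) (X Y : cprop P) : cprop P :=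
  Neg (Or (Neg X) (Neg Y)).
Definition Iff (P : Type) (X Y : cprop P) : cprop P :=
  And (Imp X Y) (Imp Y X).

Definition boolean_endomorphism (d : Order.disp_t) (E : ctbDistrLatticeType d)
    (f : E -> E) : Prop :=
  [/\ f \bot = \bot,
      f \top = \top,
      {morph f : x y / x `&` y},
      {morph f : x y / x `|` y}
    & {morph f : x / ~` x}].

(* The maps [z |-> cond x z] are Boolean morphisms from E to itself and are NOT
   required to be bijective, although the literature calls them
   "automorphisms".  With injectivity, [x][x]y = [x]y would force [x]y = y,
   hence (taking y = x in the second axiom) x = \bot or x = \top for all x. *)
Record bayesian_algebra (d : Order.disp_t) (E : ctbDistrLatticeType d)
    (cond : E -> E -> E) : Prop := BayesianAlgebra {
  cond_morph : forall x : E, boolean_endomorphism (cond x);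
  cond_top : forall x y : E, x <= y -> cond x y = \top \/ x = \bot;
  cond_meet : forall x y : E, x `&` cond x y = x `&` y;
  cond_idem : forall x y : E, cond x (cond x y) = cond x y;
  cond_compl : forall x y : E, cond (~` x) (cond x y) = cond x y
}.

Record valuation (P : Type) (d : Order.disp_t) (E : ctbDistrLatticeType d)
    (cond : E -> E -> E) (H : cprop P -> E) : Prop := Valuation {
  val_bot : H Bot = \bot;
  val_imp : forall X Y : cprop P, H (Imp X Y) = ~` H X `|` H Y;
  val_cond : forall X Y : cprop P, H (Cond X Y) = cond (H X) (H Y)
}.

(* The Bayesian proposition |_X1|...|Xn_| is the sequence [:: X1; ...; Xn],
   with n >= 1. *)
Definition bayesian_prop (P : Type) (G : seq (cprop P)) : Prop :=
  (0 < size G)%N.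

Definition satisfies (P : Type) (d : Order.disp_t) (E : ctbDistrLatticeType d)
    (H : cprop P -> E) (G : seq (cprop P)) : Prop :=
  has (fun X => H X == \top) G.

Definition valid (P : Type) (G : seq (cprop P)) : Prop :=
  forall (d : Order.disp_t) (E : ctbDistrLatticeType d) (cond : E -> E -> E)
    (H : cprop P -> E),
  bayesian_algebra cond -> valuation cond H -> satisfies H G.

(* The first three schemas are the usual Hilbert axioms of classical
   propositional logic in the connectives \bot and ->. *)
Inductive dbl_axiom (P : Type) : cprop P -> Prop :=
| ax_K (X Y : cprop P) : dbl_axiom (Imp X (Imp Y X))
| ax_S (X Y Z : cprop P) :
    dbl_axiom (Imp (Imp X (Imp Y Z)) (Imp (Imp X Y) (Imp X Z)))
| ax_DN (X : cprop P) : dbl_axiom (Imp (Neg (Neg X)) X)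
| ax_cond_imp (X Y Z : cprop P) :
    dbl_axiom (Imp (Cond X (Imp Y Z)) (Imp (Cond X Y) (Cond X Z)))
| ax_cond_elim (X Y : cprop P) : dbl_axiom (Imp (Cond X Y) (Imp X Y))
| ax_cond_neg (X Y : cprop P) :
    dbl_axiom (Iff (Cond X (Neg Y)) (Neg (Cond X Y))).

(* No rule concludes the empty sequence, so every derivable sequence is a
   Bayesian proposition, including in [dbl_weak]. *)
Inductive derivable (P : Type) : seq (cprop P) -> Prop :=
| dbl_ax (A : cprop P) : dbl_axiom A -> derivable [:: A]
| dbl_mp (G D : seq (cprop P)) (X Y : cprop P) :
    derivable (rcons G X) -> derivable (rcons D (Imp X Y)) ->
    derivable (rcons (G ++ D) Y)
| dbl_perm (G D : seq (cprop P)) :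
    Permutation G D -> derivable G -> derivable D
| dbl_contr (G : seq (cprop P)) (X : cprop P) :
    derivable (rcons (rcons G X) X) -> derivable (rcons G X)
| dbl_weak (G : seq (cprop P)) (X : cprop P) :
    derivable G -> derivable (rcons G X)
| dbl_cond (G : seq (cprop P)) (X Y : cprop P) :
    derivable (rcons G (Imp X Y)) ->
    derivable (rcons (rcons G (Neg X)) (Cond X Y))
| dbl_indep (G : seq (cprop P)) (X Y Z : cprop P) :
    derivable (rcons G (Iff Y (Neg X))) ->
    derivable (rcons G (Iff (Cond X Z) Z)) ->
    derivable (rcons G (Iff (Cond Y Z) Z)).

(* Main.v *)
(* Completeness: if G is not derivable, choose by Zorn's lemma a maximal set of
   propositions that contains G and no derivable sequence. Its complement T is
   closed under the rules read with a single conclusion, and prime: if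
   X -> Y is in T, then ~X or [X]Y is in T. Call worlds the two-valued
   extensions of T; T is the intersection of its worlds, so membership in T can
   be tested with truth tables. If U is a world, so is {Y | [X]Y in U}, and
   X <-> X' in T gives [X]Y <-> [X']Y in T. Hence the sets of worlds
   {U | X in U} form a Bayesian algebra, in which X is \top exactly when X is
   in T, so that no member of G is \top. *)

From Stdlib Require Import Permutation.
From Stdlib Require List.
Require Import Defs.
From HB Require Import structures.
From mathcomp Require Import all_boot all_order.
From mathcomp Require Import boolp classical_sets.

Set Implicit Arguments.
Unset Strict Implicit.
Unset Printing Implicit Defensive.

Import Order.Theory.

(** * Soundness in an arbitrary Bayesian algebra *)

Section Soundness.
Local Open Scope order_scope.
Variables (P : Type) (d : Order.disp_t) (E : ctbDistrLatticeType d).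
Variables (cond : E -> E -> E) (H : cprop P -> E).
Hypotheses (condA : bayesian_algebra cond) (valH : valuation cond H).
Implicit Types (X Y Z : cprop P) (G : seq (cprop P)).

Lemma val_neg X : H (Neg X) = ~` H X.
Proof. by rewrite (val_imp valH) (val_bot valH) joinx0. Qed.

(** Residuation in a Boolean algebra; it turns nested implications into bounds on meets of their
    antecedents. *)
Lemma le_val_imp a X Y : (a <= H (Imp X Y)) = (a `&` H X <= H Y).
Proof.
rewrite (val_imp valH); apply/idP/idP=> [aXY|aXY].
  apply: le_trans (leI2 aXY (lexx (H X))) _.
  by rewrite meetUl meetCx join0x leIl.
rewrite -[a]meetx1 -(joinCx (H X)) meetUr leUx.
by rewrite (le_trans (leIr _ _) (leUl _ _)) (le_trans aXY (leUr _ _)).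
Qed.

Lemma val_imp_top X Y : H (Imp X Y) = \top <-> H X <= H Y.
Proof.
rewrite -[H X]meet1x -le_val_imp le1x.
by split=> [->|/eqP].
Qed.

Lemma val_iff_top X Y : H (Iff X Y) = \top <-> H X = H Y.
Proof.
(* [Iff] unfolds to the complement of a join of complements; De Morgan turns it into a meet. *)
rewrite /Iff /And /Or val_neg (val_imp valH) !val_neg !complK.
rewrite -[_ `|` _]complK complU !complK.
split=> [XY|XY].
  have /andP[/eqP hXY /eqP hYX] :
      (H (Imp X Y) == \top) && (H (Imp Y X) == \top).
    by rewrite -meet_eq1 XY.
  by apply/eqP; rewrite eq_le; apply/andP; split; apply/val_imp_top.
by rewrite !(val_imp valH) XY joinCx meetx1.
Qed.

Lemma val_axiom X : dbl_axiom X -> H X = \top.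
Proof.
have cM x := cond_morph condA x.
case=> {X} [X Y|X Y Z|X|X Y Z|X Y|X Y].
- by apply/val_imp_top; rewrite (val_imp valH) leUr.
- apply/val_imp_top; rewrite !le_val_imp.
  set p := H (Imp X (Imp Y Z)); set q := H (Imp X Y).
  have pxyz : p `&` H X `&` H Y <= H Z by rewrite -!le_val_imp.
  have qxy : q `&` H X <= H Y by rewrite -le_val_imp.
  apply: le_trans pxyz; rewrite lexI leI2 ?leIl //=.
  by apply: le_trans qxy; rewrite leI2 ?leIr.
- by apply/val_imp_top; rewrite !val_neg complK.
- have [_ _ _ cU cC] := cM (H X).
  by apply/val_imp_top; rewrite !(val_imp valH, val_cond valH) cU cC.
- apply/val_imp_top; rewrite le_val_imp (val_cond valH) meetC.
  by rewrite (cond_meet condA) leIr.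
- have [_ _ _ _ cC] := cM (H X).
  by apply/val_iff_top; rewrite !(val_neg, val_cond valH) cC.
Qed.

Lemma satisfies_rcons G X :
  satisfies H (rcons G X) <-> H X = \top \/ satisfies H G.
Proof.
by rewrite /satisfies has_rcons; split=> [/predU1P|hXG]; [|apply/predU1P].
Qed.

Lemma derivable_satisfies G : derivable G -> satisfies H G.
Proof.
elim=> {G} [X /val_axiom hX|G D X Y _ + _|G D GD _|G X _|G X _|G X Y _
          |G X Y Z _ + _].
- by rewrite /satisfies /= hX eqxx.
- move=> /satisfies_rcons hX /satisfies_rcons hXY; apply/satisfies_rcons.
  rewrite /satisfies has_cat; case: hX => [hX|->]; last by right.
  case: hXY => [/val_imp_top|->]; last by right; rewrite orbT.
  by rewrite hX le1x => /eqP ->; left.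
- rewrite /satisfies; elim: GD => //=
    [X ? ? _ IH /orP[->|/IH->]|X Y ?|? ? ? _ IH _ IH' /IH] //.
    by rewrite orbT.
  by rewrite orbCA.
- by move=> /satisfies_rcons[hX|//]; apply/satisfies_rcons; left.
- by move=> hG; apply/satisfies_rcons; right.
- move=> /satisfies_rcons[/val_imp_top XY|hG]; last first.
    by do 2![apply/satisfies_rcons; right].
  apply/satisfies_rcons; rewrite (val_cond valH).
  (* [cond_top] is the disjunction of the rule: [X]Y is top, or X is bottom and ~X is top. *)
  have [->|X0] := cond_top condA XY; [by left|right].
  by apply/satisfies_rcons; left; rewrite val_neg X0 compl0.
- move=> /satisfies_rcons[/val_iff_top hY|hG]; last first.
    by move=> _; apply/satisfies_rcons; right.
  move=> /satisfies_rcons[/val_iff_top hZ|hG]; apply/satisfies_rcons;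
    [left|by right].
  apply/val_iff_top; move: hZ; rewrite !(val_cond valH) hY val_neg => hZ.
  (* Write [H Z] as [cond (H X) (H Z)], the form to which [cond_compl] applies. *)
  by rewrite -{1}hZ (cond_compl condA).
Qed.

End Soundness.

(** * Sequences treated as finite sets *)

Section Structural.
Variable P : Type.
Implicit Types (X Y : cprop P) (G D : seq (cprop P)).

Lemma perm_rcons X G : Permutation (rcons G X) (X :: G).
Proof. by rewrite -cats1; apply/Permutation_sym/Permutation_cons_append. Qed.

Lemma derivable_weaken G D : derivable G -> derivable (D ++ G).
Proof.
move=> dG; elim: D => //= X D /(dbl_weak X).
exact/dbl_perm/perm_rcons.
Qed.

Lemma derivable_contract G D :
  (forall X, List.In X G -> List.In X D) -> derivable (G ++ D) -> derivable D.
Proof.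
elim: G => // X G IH GD dXGD; apply: IH => [Y GY|]; first by apply: GD; right.
have [D1 [D2 defD]] := List.in_split X D (GD X (or_introl erefl)).
have pD : Permutation (rcons (G ++ D1 ++ D2) X) (G ++ D).
  rewrite defD; apply: Permutation_trans (perm_rcons _ _) _.
  by rewrite !catA; apply: Permutation_middle.
apply: (dbl_perm pD); apply: dbl_contr; apply: dbl_perm dXGD.
apply: Permutation_sym; apply: Permutation_trans (perm_rcons _ _) _.
exact: perm_skip.
Qed.

(** Weaken by [D], then absorb each member of [G] into its copy in [D]. [List.In] expresses
    membership since [P] carries no decidable equality. *)
Lemma derivable_incl G D :
  (forall X, List.In X G -> List.In X D) -> derivable G -> derivable D.
Proof.
move=> GD /(derivable_weaken D) dDG; apply: (derivable_contract GD).
by apply: dbl_perm dDG; apply: Permutation_app_comm.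
Qed.

End Structural.

Local Open Scope classical_set_scope.

(** * Prime theories from Zorn's lemma *)

Section PrimeTheory.
Variable P : Type.
Implicit Types (X Y Z : cprop P) (G D : seq (cprop P)) (T : set (cprop P)).

(** The side sequences of the rules disappear; the disjunction in [thy_cond] reflects the two
    components which that rule creates. *)
Record prime_theory T : Prop := PrimeTheory {
  thy_ax : forall X, dbl_axiom X -> T X;
  thy_mp : forall X Y, T X -> T (Imp X Y) -> T Y;
  thy_cond : forall X Y, T (Imp X Y) -> T (Neg X) \/ T (Cond X Y);
  thy_indep : forall X Y Z,
    T (Iff Y (Neg X)) -> T (Iff (Cond X Z) Z) -> T (Iff (Cond Y Z) Z)
}.

Lemma In_rcons X Y G : List.In X (rcons G Y) <-> List.In X G \/ X = Y.
Proof.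
rewrite -cats1; split=> [/List.in_app_iff[|[|//]]|]; [by left|by right|].
by move=> XGY; apply/List.in_app_iff; case: XGY => [|->]; [left|right; left].
Qed.

(** Finitely many members of a chain have a largest one; [set0] stands in when no member of [F] is
    used. *)
Lemma chain_finite_sub (F : set (set (cprop P))) A G :
    total_on F subset ->
    (forall X, List.In X G -> A X \/ (\bigcup_(B in F) B) X) ->
  exists2 B, B = set0 \/ F B & forall X, List.In X G -> A X \/ B X.
Proof.
move=> totF; elim: G => [|X G IH] GF; first by exists set0; [left|].
have [Y GY|B FB GB] := IH; first by apply: GF; right.
have [AX|[C FC CX]] := GF X (or_introl erefl).
  by exists B => // Y [<-|/GB]; [left|].
case: FB => [B0|FB].
  exists C; first by right.
  by move=> Y [<-|/GB[|]]; [right|left|rewrite B0].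
have [BC|CB] := totF _ _ FB FC.
- by exists C; [right|move=> Y [<-|/GB[|/BC]]; [right|left|right]].
- by exists B; [right|move=> Y [<-|/GB[|]]; [right; apply: CB|left|right]].
Qed.

Lemma prime_theory_avoiding G : ~ derivable G ->
  exists2 T, prime_theory T & forall X, List.In X G -> ~ T X.
Proof.
move=> ndG.
(* Sets are judged together with [G], so that [set0], the union of the empty chain, qualifies. *)
pose refutes (A : set (cprop P)) :=
  forall D, (forall X, List.In X D -> List.In X G \/ A X) -> ~ derivable D.
have [F Fref totF|A [refA maxA]] := @Zorn_bigcup (cprop P) refutes.
  move=> D DF dD; have [B FB DB] := chain_finite_sub totF DF.
  case: FB => [B0|FB]; last exact: Fref FB D DB dD.
  by apply: ndG; apply: derivable_incl dD => X /DB; rewrite B0 => -[].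
pose R X := List.In X G \/ A X.
(* In this form the rules apply directly to [T]; maximality of [A] makes it the complement of
   [R]. *)
pose T X := exists2 D, (forall Y, List.In Y D -> R Y) & derivable (rcons D X).
have TR X : T X <-> ~ R X.
  split=> [[D DR dDX] RX|nRX].
    by apply: refA dDX => Y /In_rcons[/DR|->].
  apply: contrapT => nTX; apply: (maxA (X |` A)).
    split=> [|XA]; last by apply: nRX; right; apply: XA; left.
    by move=> Y AY; right.
  move=> D DXA dD; apply: nTX.
  (* Only copies of [X] are filtered out of [D], and the final [X] restores them. *)
  exists [seq Y <- D | `[< R Y >]].
    by move=> Y /List.filter_In[_ /asboolP].
  apply: derivable_incl dD => Y DY; apply/In_rcons.
  have [RY|nRY] := pselect (R Y).
    by left; apply/List.filter_In; split=> //; apply/asboolP.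
  right; case: (DXA _ DY) => [GY|[//|AY]]; case: nRY; [by left|by right].
have TorR X : T X \/ R X by have [|/TR] := pselect (R X); [right|left].
exists T; last by move=> X GX /TR; apply; left.
split=> [X axX|X Y [D DR dX] [D' DR' dXY]|X Y [D DR dXY]
        |X Y Z [D DR dY] [D' DR' dZ]].
- by exists [::] => //; apply: dbl_ax.
- exists (D ++ D'); last exact: dbl_mp dX dXY.
  by move=> Z /List.in_app_iff[/DR|/DR'].
(* If ~X lies in [R], it joins the side components and leaves [X]Y alone at the end. *)
- have [TnX|RnX] := TorR (Neg X); [by left|right].
  exists (rcons D (Neg X)); last exact: dbl_cond.
  by move=> Z /In_rcons[/DR|->].
- exists (D ++ D').
    by move=> W /List.in_app_iff[/DR|/DR'].
  (* [dbl_indep] wants one common side sequence, so both premises are widened to [D ++ D']. *)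
  have incl W D0 : (forall V, List.In V D0 -> List.In V (D ++ D')) ->
      derivable (rcons D0 W) -> derivable (rcons (D ++ D') W).
    move=> sub; apply: derivable_incl => V /In_rcons DVW; apply/In_rcons.
    by case: DVW => [/sub|]; [left|right].
  apply: dbl_indep.
    by apply: incl dY => V DV; apply/List.in_app_iff; left.
  by apply: incl dZ => V DV; apply/List.in_app_iff; right.
Qed.

End PrimeTheory.

(** * Worlds of a prime theory and the laws of the conditional *)

Section Worlds.
Variables (P : Type) (T : set (cprop P)).
Hypothesis Tth : prime_theory T.
Implicit Types (X Y Z : cprop P) (U : set (cprop P)).

(** Conditionals are treated like atoms here, constrained only by the inclusion of [T]. *)
Record world U : Prop := World {
  world_thy : T `<=` U;
  world_bot : ~ U Bot;
  world_imp : forall X Y, U (Imp X Y) <-> (U X -> U Y)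
}.

Definition deductive U : Prop :=
  (forall X, dbl_axiom X -> U X) /\ forall X Y, U X -> U (Imp X Y) -> U Y.

(** The combinator identity S K K = I. *)
Lemma deductive_imp_refl U X : deductive U -> U (Imp X X).
Proof.
move=> [Uax Ump].
apply: (Ump _ _ (Uax _ (ax_K X X))).
exact: Ump (Uax _ (ax_K X (Imp X X))) (Uax _ (ax_S _ _ _)).
Qed.

(** Deduction theorem: the set holds what follows from [U] and [X], and schema S closes it under
    modus ponens. *)
Lemma deductive_add U X : deductive U -> deductive [set Y | U (Imp X Y)].
Proof.
move=> [Uax Ump]; split=> [Y axY|Y Z XY XYZ] /=.
  exact: Ump (Uax _ axY) (Uax _ (ax_K _ _)).
exact: Ump XY (Ump _ _ XYZ (Uax _ (ax_S _ _ _))).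
Qed.

(** Lindenbaum's lemma: modus ponens and consistency involve finitely many propositions, hence pass
    to unions of chains. *)
Lemma deductive_maximal_consistent U : deductive U -> ~ U Bot ->
  exists V, [/\ deductive V, ~ V Bot, U `<=` V
    & forall W, deductive W -> ~ W Bot -> V `<=` W -> W `<=` V].
Proof.
move=> [Uax Ump] Ubot.
(* Joining [A] to [U] makes the empty chain give back [U]. *)
have [F Fcons totF|A [[dA Abot] maxA]] :=
    @Zorn_bigcup _ [set A | deductive (U `|` A) /\ ~ (U `|` A) Bot].
  split=> [|[//|[A FA Abot]]]; last by have [_ []] := Fcons _ FA; right.
  split=> [X axX|X Y UX UXY]; first by left; apply: Uax.
  have [|B FB BXY] := @chain_finite_sub _ F U [:: X; Imp X Y] totF.
    by move=> Z /= [<-|[<-|//]].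
  have [BX BImp] : (U `|` B) X /\ (U `|` B) (Imp X Y).
    by split; apply: BXY; [left|right; left].
  case: FB => [B0|FB].
    by move: BX BImp; rewrite B0 !setU0 => BX BImp; left; apply: Ump BX BImp.
  have [[_ Bmp] _] := Fcons _ FB.
  by case: (Bmp _ _ BX BImp) => [|BY]; [left|right; exists B].
exists (U `|` A); split=> // W dW Wbot UAW X WX.
apply: contrapT => nUAX; apply: (maxA W); last first.
  have UW : U `|` W = W.
    by apply: setUidr; apply: subset_trans UAW; apply: subsetUl.
  by split; rewrite UW.
split=> [Y AY|WA]; first by apply: UAW; right.
by apply: nUAX; right; apply: WA.
Qed.

(** Maximality decides every proposition: if [X] is not in [U], adding it must yield [Bot], so
    [Neg X] is in [U]. *)
Lemma maximal_consistent_imp U : deductive U -> ~ U Bot ->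
    (forall W, deductive W -> ~ W Bot -> U `<=` W -> W `<=` U) ->
  forall X Y, U (Imp X Y) <-> (U X -> U Y).
Proof.
move=> dU Ubot Umax; have [Uax Ump] := dU.
have UK X Y : U Y -> U (Imp X Y) by move=> UY; apply: Ump UY (Uax _ (ax_K _ _)).
have Uneg X : ~ U X -> U (Neg X).
  move=> nUX; apply: contrapT => nUnX; apply: nUX.
  apply: (Umax _ (deductive_add X dU)) => // [Y UY|]; first exact: UK.
  exact: deductive_imp_refl.
move=> X Y; split=> [UXY UX|UXY]; first exact: Ump UX UXY.
have [/UXY|/Uneg UnX] := pselect (U X); first exact: UK.
have [_ Xmp] := deductive_add X dU.
(* Under [X] there is [Bot]; an instance of K gives Bot -> ~~Y, and double negation elimination
   ends. *)
by apply: (Xmp (Neg (Neg Y))); [apply: (Xmp Bot _ UnX)|]; apply: UK;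
  apply: Uax; constructor.
Qed.

(** If [X] is not in [T], then [T] with ~X is consistent by double negation elimination, and a
    maximal consistent extension is a world without [X]. *)
Lemma thyP X : T X <-> forall U, world U -> U X.
Proof.
split=> [TX U /world_thy|TX]; first exact.
have dT : deductive T by split; [exact: thy_ax|exact: thy_mp].
apply: contrapT => nTX.
have [|V [dV Vbot TV Vmax]] :=
    deductive_maximal_consistent (deductive_add (Neg X) dT).
  move=> /= TnnX; apply: nTX; apply: (thy_mp Tth TnnX).
  by apply: (thy_ax Tth); constructor.
have Vimp := maximal_consistent_imp dV Vbot Vmax.
have VT : T `<=` V.
  move=> Y TY; apply: TV; apply: (thy_mp Tth TY); apply: (thy_ax Tth).
  exact: ax_K.
have VX : V X by apply: TX.
have /Vimp/(_ VX) // : V (Neg X).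
by apply: TV; apply: deductive_imp_refl.
Qed.

Section World.
Variable U : set (cprop P).
Hypothesis wU : world U.

Lemma world_neg X : U (Neg X) <-> ~ U X.
Proof. by rewrite (world_imp wU); have := world_bot wU; tauto. Qed.

Lemma world_or X Y : U (Or X Y) <-> U X \/ U Y.
Proof.
rewrite (world_imp wU) world_neg; have [] := pselect (U X); tauto.
Qed.

Lemma world_and X Y : U (And X Y) <-> U X /\ U Y.
Proof.
rewrite world_neg world_or !world_neg.
by have [] := pselect (U X); have [] := pselect (U Y); tauto.
Qed.

Lemma world_iff X Y : U (Iff X Y) <-> (U X <-> U Y).
Proof. by rewrite world_and !(world_imp wU). Qed.

Lemma world_cond_neg X Y : U (Cond X (Neg Y)) <-> ~ U (Cond X Y).
Proof.
rewrite -world_neg -world_iff; apply: (world_thy wU).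
by apply: thy_ax => //; constructor.
Qed.

(** Under X, [X]Y gives Y; the converse applies this to ~Y, as [X] commutes with negation. *)
Lemma world_condE X Y : U X -> U (Cond X Y) <-> U Y.
Proof.
have elim Z : U (Cond X Z) -> U X -> U Z.
  rewrite -2!(world_imp wU); apply: (world_thy wU).
  by apply: thy_ax => //; constructor.
move=> UX; split=> [/elim|UY]; first exact.
by apply: contrapT => /world_cond_neg/elim/(_ UX)/world_neg.
Qed.

End World.

(* [~X]Z <-> Z holds because ~X is true in every world; then independence. *)
Lemma thy_cond_neg X Z : T (Neg X) -> T (Iff (Cond X Z) Z).
Proof.
move=> TnX; apply: (@thy_indep _ _ Tth (Neg X)).
  apply/thyP=> U wU; rewrite world_iff // !world_neg //.
  by have [] := pselect (U X); tauto.
apply/thyP=> U wU; apply/world_iff => //; apply: world_condE => //.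
exact: world_thy.
Qed.

(** Necessitation: X -> Y is in [T], so ~X or [X]Y is; in the first case [X]Y <-> Y. *)
Lemma thy_nec X Y : T Y -> T (Cond X Y).
Proof.
move=> TY; have [|TnX|//] := @thy_cond _ _ Tth X Y.
  by apply/thyP=> U wU; apply/(world_imp wU) => _; apply: world_thy.
have /thyP TXY := thy_cond_neg Y TnX.
apply/thyP=> U wU; have /(world_iff wU) UXY := TXY _ wU.
by apply/UXY; exact: (world_thy wU TY).
Qed.

(** In Kripke terms each [X] acts as a function on worlds: [X] is a normal modality commuting with
    negation. *)
Lemma world_cond X U : world U -> world [set Y | U (Cond X Y)].
Proof.
move=> wU; split=> /= [Y /(thy_nec X)|UXbot|Y Z].
- exact: (world_thy wU).
- have : U (Cond X (Neg Bot)).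
    apply: (world_thy wU); apply: thy_nec; apply/thyP=> V wV.
    by apply/world_neg => //; apply: world_bot.
  by move/(world_cond_neg wU).
(* Used below for Z -> (Y -> Z) and ~Y -> (Y -> Z). *)
have mono A B : T (Imp A B) -> U (Cond X A) -> U (Cond X B).
  move=> /(thy_nec X)/(world_thy wU) UXAB; move: UXAB.
  rewrite -!(world_imp wU); apply: (world_thy wU).
  by apply: thy_ax => //; constructor.
split=> [|UXYZ].
  rewrite -!(world_imp wU); apply: (world_thy wU).
  by apply: thy_ax => //; constructor.
have [/UXYZ|/(world_cond_neg wU)] := pselect (U (Cond X Y)); apply: mono;
  by apply/thyP=> V wV; have := world_bot wV; rewrite !(world_imp wV); tauto.
Qed.

(** X -> ([X]Y <-> Y) is in [T], so by primality either ~X is, and [X] acts trivially, or [X]([X]Y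
    <-> Y) is, and [X] distributes over <->. *)
Lemma thy_cond_idem X Y : T (Iff (Cond X (Cond X Y)) (Cond X Y)).
Proof.
have [|/thy_cond_neg//|TX] := @thy_cond _ _ Tth X (Iff (Cond X Y) Y).
  apply/thyP=> U wU; apply/world_imp => // UX; apply/world_iff => //.
  exact: world_condE.
apply/thyP=> U wU; apply/world_iff => //.
by apply/(world_iff (world_cond X wU)); apply: world_thy TX.
Qed.

Lemma thy_cond_compl X Y : T (Iff (Cond (Neg X) (Cond X Y)) (Cond X Y)).
Proof.
apply: thy_indep (thy_cond_idem X Y) => //.
by apply/thyP=> U wU; apply/world_iff.
Qed.

(** The second argument goes through worlds. For the first, X' -> ([X]Y' <-> Y') is in [T]: if ~X'
    is in [T], both conditionals reduce to Y'; otherwise [X'][X]Y' <-> [X']Y', and it remains to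
    remove the outer [X'] on the left. *)
Lemma thy_cond_congr X X' Y Y' :
  T (Iff X X') -> T (Iff Y Y') -> T (Iff (Cond X Y) (Cond X' Y')).
Proof.
move=> /thyP XX' /thyP YY'.
have {YY'}YY' : T (Iff (Cond X Y) (Cond X Y')).
  apply/thyP=> U wU; have wXU := world_cond X wU.
  by apply/world_iff => //; apply/(world_iff wXU); apply: YY'.
suff TXX' : T (Iff (Cond X Y') (Cond X' Y')).
  move: YY' TXX' => /thyP YY' /thyP TXX'; apply/thyP=> U wU.
  have := YY' _ wU; have := TXX' _ wU; rewrite !world_iff //; tauto.
have [|TnX|] := @thy_cond _ _ Tth X' (Iff (Cond X Y') Y').
- apply/thyP=> U wU; apply/world_imp => // UX'; apply/world_iff => //.
  apply: world_condE => //.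
  by have /(world_iff wU)[_] := XX' _ wU; apply.
- have TnX0 : T (Neg X).
    move/thyP: TnX => TnX; apply/thyP=> U wU; have := TnX _ wU.
    have := XX' _ wU; rewrite world_iff // !world_neg //; tauto.
  have /thyP TX := thy_cond_neg Y' TnX0; have /thyP TX' := thy_cond_neg Y' TnX.
  apply/thyP=> U wU; have := TX _ wU; have := TX' _ wU.
  by rewrite !world_iff //; tauto.
move=> /thyP TX'.
(* [~X][X]Y' <-> [X]Y' and X' <-> ~~X, so independence applies. *)
have /thyP TX'X : T (Iff (Cond X' (Cond X Y')) (Cond X Y')).
  apply: thy_indep (thy_cond_compl X Y') => //.
  apply/thyP=> U wU; have := XX' _ wU; rewrite !world_iff // !world_neg //.
  by have [] := pselect (U X); tauto.
apply/thyP=> U wU; have := TX'X _ wU.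
have : U (Cond X' (Iff (Cond X Y') Y')) by exact: TX'.
by move/(world_iff (world_cond X' wU)); rewrite /= !world_iff //; tauto.
Qed.

End Worlds.

(** * The canonical algebra of definable sets of worlds *)

Section CanonicalAlgebra.
Local Open Scope order_scope.
Variables (P : Type) (T : set (cprop P)).
Hypothesis Tth : prime_theory T.
Implicit Types (X Y Z : cprop P).

Definition truth_set X : set {U | world T U} := [set U | sval U X].

Definition definable : pred (set {U | world T U}) :=
  fun A => `[< exists X, A = truth_set X >].

Lemma truth_setI X Y : truth_set X `&` truth_set Y = truth_set (And X Y).
Proof. by apply/seteqP; split=> -[U wU] /= /(world_and wU). Qed.

Lemma truth_setU X Y : truth_set X `|` truth_set Y = truth_set (Or X Y).
Proof. by apply/seteqP; split=> -[U wU] /= /(world_or wU). Qed.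

Lemma truth_setC X : ~` truth_set X = truth_set (Neg X).
Proof. by apply/seteqP; split=> -[U wU] /= /(world_neg wU). Qed.

Lemma truth_set0 : \bot = truth_set Bot.
Proof. by apply/seteqP; split=> -[U wU] // /(world_bot wU). Qed.

Lemma truth_setT : \top = truth_set (Neg Bot).
Proof. by rewrite -truth_setC -truth_set0 compl0. Qed.

Lemma truth_set_eq X Y : truth_set X = truth_set Y <-> T (Iff X Y).
Proof.
rewrite (thyP Tth); split=> [XY U wU|XY].
  apply/(world_iff wU).
  by have := congr1 (fun A => A (exist _ U wU)) XY; rewrite /truth_set /= => ->.
by apply/seteqP; split=> -[U wU] /=; have /(world_iff wU)[] := XY U wU.
Qed.

Lemma truth_set_top X : truth_set X = \top <-> T X.
Proof.
rewrite truth_setT truth_set_eq !(thyP Tth).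
by split=> XT U wU; have := XT U wU; have := world_bot wU;
  rewrite (world_iff wU) (world_neg wU); tauto.
Qed.

Lemma definableI : Order.ClosedPredicates.meet_closed definable.
Proof.
move=> A B /asboolP[X ->] /asboolP[Y ->]; apply/asboolP.
by exists (And X Y); apply: truth_setI.
Qed.

Lemma definableU : Order.ClosedPredicates.join_closed definable.
Proof.
move=> A B /asboolP[X ->] /asboolP[Y ->]; apply/asboolP.
by exists (Or X Y); apply: truth_setU.
Qed.

Lemma definableC A : definable A -> definable (~` A).
Proof.
by move=> /asboolP[X ->]; apply/asboolP; exists (Neg X); apply: truth_setC.
Qed.

Lemma definable0 : \bot \in definable.
Proof. by apply/asboolP; exists Bot; apply: truth_set0. Qed.

Lemma definable1 : \top \in definable.
Proof. by apply/asboolP; exists (Neg Bot); apply: truth_setT. Qed.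

(** Definable sets rather than all sets of worlds, because the conditional is read off from
    formulas. *)
Definition definable_set : Type := {A | definable A}.

HB.instance Definition _ := [isSub of definable_set for sval].
HB.instance Definition _ := [Choice of definable_set by <:].
HB.instance Definition _ := Order.SubChoice_isTBSubLattice.Build _ _ definable
  set_display definable_set definableI definableU definable0 definable1.

Lemma definable_meetUl :
  left_distributive (@Order.meet _ definable_set) (@Order.join _ definable_set).
Proof. by move=> A B C; apply: val_inj; exact: meetUl. Qed.

HB.instance Definition _ := Order.Lattice_Meet_isDistrLattice.Build
  set_display definable_set definable_meetUl.

Definition definable_compl (A : definable_set) : definable_set :=
  Sub (~` val A) (definableC (valP A)).

Lemma definable_joinxC A : A `|` definable_compl A = \top.
Proof. by apply: val_inj; exact: joinxC. Qed.

Lemma definable_meetxC A : A `&` definable_compl A = \bot.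
Proof. by apply: val_inj; exact: meetxC. Qed.

HB.instance Definition _ := Order.TBDistrLattice_hasComplement.Build
  set_display definable_set definable_joinxC definable_meetxC.

Definition truth X : definable_set :=
  Sub (truth_set X) (asboolT (ex_intro _ X erefl)).

Lemma truth_surj (A : definable_set) : exists X, A = truth X.
Proof. by have /asboolP[X AX] := valP A; exists X; apply: val_inj. Qed.

Lemma truth_eq X Y : truth X = truth Y <-> T (Iff X Y).
Proof.
by rewrite -truth_set_eq; split=> [/(congr1 val)//|XY]; apply: val_inj.
Qed.

Lemma truth_top X : truth X = \top <-> T X.
Proof.
by rewrite -truth_set_top; split=> [/(congr1 val)//|XY]; apply: val_inj.
Qed.

Lemma truthI X Y : truth X `&` truth Y = truth (And X Y).
Proof. by apply: val_inj; exact: truth_setI. Qed.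

Lemma truthU X Y : truth X `|` truth Y = truth (Or X Y).
Proof. by apply: val_inj; exact: truth_setU. Qed.

Lemma truthC X : ~` truth X = truth (Neg X).
Proof. by apply: val_inj; exact: truth_setC. Qed.

Lemma truth0 : \bot = truth Bot.
Proof. by apply: val_inj; exact: truth_set0. Qed.

Lemma truth1 : \top = truth (Neg Bot).
Proof. by apply: val_inj; exact: truth_setT. Qed.

(** Representatives are picked by choice; [thy_cond_congr] makes the result independent of them. *)
Definition canonical_cond (A B : definable_set) : definable_set :=
  truth (Cond (sval (cid (truth_surj A))) (sval (cid (truth_surj B)))).

Lemma canonical_cond_truth X Y :
  canonical_cond (truth X) (truth Y) = truth (Cond X Y).
Proof.
rewrite /canonical_cond; case: cid => X' /= XX'; case: cid => Y' /= YY'.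
by apply/truth_eq; apply: (thy_cond_congr Tth); apply/truth_eq.
Qed.

Lemma canonical_valuation : valuation canonical_cond truth.
Proof.
split=> [|X Y|X Y]; first by rewrite -truth0.
  rewrite truthC truthU; apply/truth_eq/(thyP Tth) => U wU.
  by rewrite (world_iff wU) (world_or wU) (world_neg wU) (world_imp wU);
    have [] := pselect (U X); tauto.
by rewrite canonical_cond_truth.
Qed.

Lemma canonical_algebra : bayesian_algebra canonical_cond.
Proof.
have eqT X Y : (forall U, world T U -> U X <-> U Y) -> truth X = truth Y.
  by move=> XY; apply/truth_eq/(thyP Tth) => U wU; apply/(world_iff wU)/XY.
split=> A.
(* Conditioning on X is preimage under the map of [world_cond], so it respects every Boolean
   operation. *)
- have [X ->] := truth_surj A; split=> [||B C|B C|B].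
  + rewrite truth0 canonical_cond_truth; apply: eqT => U wU.
    have := world_bot (world_cond Tth X wU); have := world_bot wU.
    by rewrite /=; tauto.
  + rewrite truth1 canonical_cond_truth; apply: eqT => U wU.
    have := world_neg (world_cond Tth X wU) Bot; rewrite (world_neg wU) /=.
    have := world_bot (world_cond Tth X wU); have := world_bot wU.
    by rewrite /=; tauto.
  + have [Y ->] := truth_surj B; have [Z ->] := truth_surj C.
    rewrite truthI !canonical_cond_truth truthI; apply: eqT => U wU.
    by rewrite (world_and wU); exact: (world_and (world_cond Tth X wU)).
  + have [Y ->] := truth_surj B; have [Z ->] := truth_surj C.
    rewrite truthU !canonical_cond_truth truthU; apply: eqT => U wU.
    by rewrite (world_or wU); exact: (world_or (world_cond Tth X wU)).
  + have [Y ->] := truth_surj B.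
    rewrite truthC !canonical_cond_truth truthC; apply: eqT => U wU.
    by rewrite (world_neg wU); exact: (world_neg (world_cond Tth X wU)).
- move=> B; have [X ->] := truth_surj A; have [Y ->] := truth_surj B.
  (* The inclusion says that X -> Y is in [T]. Primality gives the alternative: with ~X in [T],
     [truth X] is the complement of top. *)
  rewrite -(val_imp_top canonical_valuation) canonical_cond_truth.
  move=> /truth_top/(thy_cond Tth)[TnX|TXY]; last by left; apply/truth_top.
  by right; rewrite -[truth X]complK truthC (truth_top _).2 // compl1.
- move=> B; have [X ->] := truth_surj A; have [Y ->] := truth_surj B.
  rewrite canonical_cond_truth !truthI; apply: eqT => U wU.
  rewrite !(world_and wU); have [UX|] := pselect (U X); last by tauto.
  by rewrite (world_condE Tth wU) //; tauto.
- move=> B; have [X ->] := truth_surj A; have [Y ->] := truth_surj B.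
  by rewrite !canonical_cond_truth; apply/truth_eq/(thy_cond_idem Tth).
- move=> B; have [X ->] := truth_surj A; have [Y ->] := truth_surj B.
  by rewrite truthC !canonical_cond_truth; apply/truth_eq/(thy_cond_compl Tth).
Qed.

End CanonicalAlgebra.

(** * Soundness and completeness *)

Theorem theorem4 (P : Type) (G : seq (cprop P)) (hG : bayesian_prop G) :
  derivable G <-> valid G.
Proof.
split=> [dG d E cond H condA valH|vG].
  exact: (derivable_satisfies condA valH).
apply: contrapT => /prime_theory_avoiding[T Tth TG].
have := vG _ _ _ _ (canonical_algebra Tth) (canonical_valuation Tth).
(* A member of [G] equal to top would lie in [T], which avoids [G]. *)
rewrite /satisfies; elim: G TG {hG vG} => //= X G IH TG.
case/orP=> [/eqP/(truth_top Tth)|hG]; first by apply: TG; left.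
by apply: IH hG => Y GY; apply: TG; right.
Qed.
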